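(* Let $2\le l\le m\le n$ be integers with $\frac1l+\frac1m+\frac1n<1$ and let $$T=T(l,m,n)=\langle a,b\mid a^{l}=b^{m}=(ab)^{n}=1\rangle .$$ Then the trivial $\mathbb{Z}T$-module $\mathbb{Z}$ has a free resolution, $2$-periodic in degrees $\ge2$, of the form $$\cdots\xrightarrow{\partial_3}\mathbb{Z}T^{3}\xrightarrow{\partial_4}\mathbb{Z}T^{3}\xrightarrow{\partial_3}\mathbb{Z}T^{3}\xrightarrow{\partial_2}\mathbb{Z}T^{2}\xrightarrow{\partial_1}\mathbb{Z}T\xrightarrow{\varepsilon}\mathbb{Z}\to0,$$ where the differential in every odd degree $\ge3$ is $\partial_3$, the differential in every even degree $\ge4$ is $\partial_4$, and $$\partial_1=\begin{bmatrix} a-1 \\ b-1 \end{bmatrix},\quad \partial_2=\begin{bmatrix} \mathbf N_a^{l-1} & 0 \\ \mathbf N_{ab}^{n-1} & \mathbf N_{ab}^{n-1}\cdot a-\mathbf N_b^{m-1} \\ \mathbf N_{ba}^{n-1}\cdot b-\mathbf N_a^{l-1} & \mathbf N_{ba}^{n-1} \end{bmatrix},\quad \partial_3=\begin{bmatrix} a-1 & 0 & 0 \\ b-1 & 0 & ba-1 \\ 0 & 1-b & 1-a \end{bmatrix},$$ $$\partial_4=\begin{bmatrix} \mathbf N_a^{l-1} & 0 & 0 \\ \mathbf N_{ab}^{n-1} & \mathbf N_{ab}^{n-1}\cdot a-\mathbf N_b^{m-1} & -\mathbf N_b^{m-1} \\ \mathbf N_{ba}^{n-1}\cdot b-\mathbf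 N_a^{l-1} & \mathbf N_{ba}^{n-1} & 0 \end{bmatrix}.$$
   Context: All modules are left modules. A map of free modules $A^{r}\to A^{s}$ over a ring $A$ is represented by an $r\times s$ matrix acting on the right of row vectors. For a group element $g$ and an integer $k\ge0$, $\mathbf N_g^{k}:=\sum_{i=0}^{k}g^i$ in the integral group ring. $\varepsilon$ is the augmentation map. *)

(* Defs.v *)
From HB Require Import structures.
From mathcomp Require Import all_boot all_order all_algebra fingroup.
From mathcomp Require Import finmap boolp generic_quotient.
From mathcomp.multinomials Require Import monalg.

Set Implicit Arguments.
Unset Strict Implicit.
Unset Printing Implicit Defensive.

Import GRing.Theory.
Local Open Scope quotient_scope.
Local Open Scope ring_scope.

(* The letter (x, false) stands for the generator x, (x, true) for x^-1. *)
Definition word (I : choiceType) := seq (I * bool).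

Definition word_inv (I : choiceType) (u : word I) : word I :=
  rev [seq (c.1, ~~ c.2) | c <- u].

Definition word_exp (I : choiceType) (u : word I) (k : nat) : word I :=
  flatten (nseq k u).

(* The congruence on words whose quotient is < I | rels >. *)
Inductive word_eq (I : choiceType) (rels : seq (word I)) :
    word I -> word I -> Prop :=
| WeqRefl u : word_eq rels u u
| WeqSym u v : word_eq rels u v -> word_eq rels v u
| WeqTrans u v w : word_eq rels u v -> word_eq rels v w -> word_eq rels u w
| WeqCat u u' v v' :
    word_eq rels u u' -> word_eq rels v v' -> word_eq rels (u ++ v) (u' ++ v')
| WeqCancel x e : word_eq rels [:: (x, e); (x, ~~ e)] [::]
| WeqRel r : r \in rels -> word_eq rels r [::].

Section PresentedGroup.
Context (I : choiceType) (rels : seq (word I)).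
Implicit Types u v w : word I.

Definition word_eqb : rel (word I) := fun u v => `[< word_eq rels u v >].

Lemma word_eqb_refl : reflexive word_eqb.
Proof. by move=> u; apply/asboolP; apply: WeqRefl. Qed.

Lemma word_eqb_sym : symmetric word_eqb.
Proof. by move=> u v; apply/asboolP/asboolP; apply: WeqSym. Qed.

Lemma word_eqb_trans : transitive word_eqb.
Proof.
by move=> v u w /asboolP uv /asboolP vw; apply/asboolP; apply: WeqTrans vw.
Qed.

Canonical word_equiv :=
  EquivRel word_eqb word_eqb_refl word_eqb_sym word_eqb_trans.

Definition presented := {eq_quot word_equiv}.
HB.instance Definition _ := Choice.on presented.

Definition pclass u : presented := \pi_presented u.

Lemma pclassP u v : pclass u = pclass v <-> word_eq rels u v.
Proof.
split=> [/eqP|uv]; first by rewrite eqmodE => /asboolP.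
by apply/eqP; rewrite eqmodE; apply/asboolP.
Qed.

Lemma pclassK (x : presented) : pclass (repr x) = x.
Proof. exact: reprK. Qed.

Lemma word_eq_repr u : word_eq rels (repr (pclass u)) u.
Proof. by apply/pclassP; rewrite pclassK. Qed.

Definition pone : presented := pclass [::].
Definition pmul (x y : presented) : presented := pclass (repr x ++ repr y).
Definition pinv (x : presented) : presented := pclass (word_inv (repr x)).

Lemma pmulE u v : pmul (pclass u) (pclass v) = pclass (u ++ v).
Proof. by apply/pclassP; apply: WeqCat; apply: word_eq_repr. Qed.

Lemma word_invM u v : word_inv (u ++ v) = word_inv v ++ word_inv u.
Proof. by rewrite /word_inv map_cat rev_cat. Qed.

Lemma word_invK : involutive (@word_inv I).
Proof.
move=> u; rewrite /word_inv map_rev revK -map_comp map_id_in //.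
by move=> [x e] _ /=; rewrite negbK.
Qed.

Lemma word_eq_mulV u : word_eq rels (u ++ word_inv u) [::].
Proof.
elim: u => [|[x e] u IHu]; first exact: WeqRefl.
rewrite -cat1s word_invM -catA [u ++ _]catA.
apply: WeqTrans (WeqCancel rels x e).
rewrite -[X in word_eq _ _ X]/([:: (x, e)] ++ ([::] ++ word_inv [:: (x, e)])).
by apply: WeqCat (WeqRefl _ _) _; apply: WeqCat IHu (WeqRefl _ _).
Qed.

Lemma word_eq_mulN u : word_eq rels (word_inv u ++ u) [::].
Proof. by rewrite -{2}[u]word_invK; apply: word_eq_mulV. Qed.

Lemma pmulA : associative pmul.
Proof.
move=> x y z; rewrite -[x]pclassK -[y]pclassK -[z]pclassK.
by rewrite !pmulE catA.
Qed.

Lemma pmul1g : left_id pone pmul.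
Proof. by move=> x; rewrite -[x]pclassK pmulE. Qed.

Lemma pmulg1 : right_id pone pmul.
Proof. by move=> x; rewrite -[x]pclassK pmulE cats0. Qed.

Lemma pmulVg : left_inverse pone pinv pmul.
Proof.
move=> x; rewrite -{2}[x]pclassK pmulE; apply/pclassP; exact: word_eq_mulN.
Qed.

Lemma pmulgV : right_inverse pone pinv pmul.
Proof.
move=> x; rewrite -{1}[x]pclassK pmulE; apply/pclassP; exact: word_eq_mulV.
Qed.

HB.instance Definition _ :=
  isGroup.Build presented pmulA pmul1g pmulg1 pmulVg pmulgV.

Definition pgen (x : I) : presented := pclass [:: (x, false)].

End PresentedGroup.

(* [monalg] only equips {malg R[K]} with a product when K is a [monomType],
   which excludes nontrivial groups; hence the alias and the product below.
   [gr_of] and [gr_mul] are locked to keep unification from unfolding them. *)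
Definition group_ring (R : nzRingType) (G : groupType) := {malg R[G]}.

HB.instance Definition _ (R : nzRingType) (G : groupType) :=
  GRing.Zmodule.copy (group_ring R G) {malg R[G]}.

HB.lock Definition gr_of (R : nzRingType) (G : groupType) (g : G) : group_ring R G :=
  mkmalgU g 1.

HB.lock Definition gr_mul (R : nzRingType) (G : groupType) (x y : group_ring R G) :
    group_ring R G :=
  \sum_(g <- msupp x) \sum_(h <- msupp y) mkmalgU (g * h)%g (x@_g * y@_h).

Section GroupRing.
Context (R : nzRingType) (G : groupType).
Local Notation RG := (group_ring R G).

Implicit Types (x y z : RG) (g h : G).

Local Notation "c '*u' g" := (mkmalgU g c : RG) (at level 40).

Lemma gr_ofE g : gr_of R g = 1 *u g.
Proof. by rewrite gr_of.unlock. Qed.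

Definition gr_one : RG := gr_of R 1%g.

Local Notation gr_mul := (@gr_mul R G).

Lemma gr_mulEw (d1 d2 : {fset G}) x y :
  (msupp x `<=` d1)%fset -> (msupp y `<=` d2)%fset ->
  gr_mul x y = \sum_(g <- d1) \sum_(h <- d2) (x@_g * y@_h) *u (g * h)%g.
Proof.
move=> le1 le2; rewrite gr_mul.unlock (big_fset_incl _ le1) /=.
  apply/eq_bigr=> g _; apply/big_fset_incl => // h _ /mcoeff_outdom ->.
  by rewrite mulr0 monalgU0.
move=> g _ /mcoeff_outdom xg.
by rewrite big1 => // h _; rewrite xg mul0r monalgU0.
Qed.

Lemma gr_mulDl : left_distributive gr_mul +%R.
Proof.
move=> x y z; set d := (msupp x `|` msupp y)%fset.
rewrite !(@gr_mulEw d (msupp z)) ?fsubsetUl ?fsubsetUr ?msuppD_le ?fsubset_refl //.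
rewrite -big_split; apply/eq_bigr=> g _; rewrite -big_split; apply/eq_bigr=> h _.
by rewrite mcoeffD mulrDl monalgUD.
Qed.

Lemma gr_mulDr : right_distributive gr_mul +%R.
Proof.
move=> z x y; set d := (msupp x `|` msupp y)%fset.
rewrite !(@gr_mulEw (msupp z) d) ?fsubsetUl ?fsubsetUr ?msuppD_le ?fsubset_refl //.
rewrite -big_split; apply/eq_bigr=> g _; rewrite -big_split; apply/eq_bigr=> h _.
by rewrite mcoeffD mulrDr monalgUD.
Qed.

Lemma gr_mul0 y : gr_mul 0 y = 0.
Proof. by rewrite gr_mul.unlock msupp0 big_seq_fset0. Qed.

Lemma gr_mulr0 x : gr_mul x 0 = 0.
Proof. by rewrite gr_mul.unlock msupp0 big1 // => g _; rewrite big_seq_fset0. Qed.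

Lemma gr_mulUU c d g h : gr_mul (c *u g) (d *u h) = (c * d) *u (g * h)%g.
Proof. by rewrite (gr_mulEw msuppU_le msuppU_le) !big_seq_fset1 !mcoeffUU. Qed.

Lemma gr_ind (P : RG -> Prop) :
  P 0 -> (forall x y, P x -> P y -> P (x + y)) -> (forall c g, P (c *u g)) ->
  forall x, P x.
Proof. by move=> P0 PD PU x; rewrite [x]monalgE; apply: big_ind. Qed.

Lemma gr_mulA : associative gr_mul.
Proof.
elim/gr_ind=> [y z|x x' IHx IHx' y z|c g]; first by rewrite !gr_mul0.
  by rewrite !gr_mulDl IHx IHx'.
elim/gr_ind=> [z|y y' IHy IHy' z|d h]; first by rewrite gr_mulr0 !gr_mul0 gr_mulr0.
  by rewrite gr_mulDl !gr_mulDr gr_mulDl IHy IHy'.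
elim/gr_ind=> [|z z' IHz IHz'|e k]; first by rewrite !gr_mulr0.
  by rewrite !gr_mulDr IHz IHz'.
by rewrite !gr_mulUU mulrA mulgA.
Qed.

Lemma gr_mul1l : left_id gr_one gr_mul.
Proof.
elim/gr_ind=> [|x y IHx IHy|c g]; first exact: gr_mulr0.
  by rewrite gr_mulDr IHx IHy.
by rewrite /gr_one gr_ofE gr_mulUU mul1r mul1g.
Qed.

Lemma gr_mul1r : right_id gr_one gr_mul.
Proof.
elim/gr_ind=> [|x y IHx IHy|c g]; first exact: gr_mul0.
  by rewrite gr_mulDl IHx IHy.
by rewrite /gr_one gr_ofE gr_mulUU mulr1 mulg1.
Qed.

Lemma gr_one_neq0 : gr_one != 0.
Proof.
by rewrite /gr_one gr_ofE; apply/eqP=> /malgP/(_ 1%g)/eqP; rewrite mcoeffUU mcoeff0 oner_eq0.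
Qed.

HB.instance Definition _ := GRing.Zmodule_isNzRing.Build RG
  gr_mulA gr_mul1l gr_mul1r gr_mulDl gr_mulDr gr_one_neq0.

Definition gr_aug x : R := \sum_(g <- msupp x) x@_g.

Lemma gr_augE x : gr_aug x = mmap idfun (fun=> 1) x.
Proof. by rewrite mmapE; apply/eq_bigr=> g _; rewrite mulr1. Qed.

Lemma gr_aug_additive : zmod_morphism gr_aug.
Proof. by move=> x y; rewrite !gr_augE raddfB. Qed.

HB.instance Definition _ := GRing.isZmodMorphism.Build RG R gr_aug gr_aug_additive.

Lemma gr_augU c g : gr_aug (c *u g) = c.
Proof. by rewrite gr_augE mmapU mulr1. Qed.

Lemma gr_aug_multiplicative : monoid_morphism gr_aug.
Proof.
split=> [|x y]; first exact: etrans (congr1 gr_aug (gr_ofE 1%g)) (gr_augU 1 1%g).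
rewrite [in LHS]/GRing.mul /= gr_mul.unlock raddf_sum mulr_suml.
apply/eq_bigr=> g _; rewrite raddf_sum mulr_sumr.
by apply/eq_bigr=> h _; rewrite /= gr_augU.
Qed.

HB.instance Definition _ :=
  GRing.isMonoidMorphism.Build RG R gr_aug gr_aug_multiplicative.

End GroupRing.

Definition trivial_module (R : nzRingType) (G : groupType) : Type := R.

Section TrivialModule.
Context (R : nzRingType) (G : groupType).
Local Notation M := (trivial_module R G).

HB.instance Definition _ := GRing.Zmodule.copy M R.

Definition triv_scale (x : group_ring R G) (c : M) : M := gr_aug x * (c : R).

Lemma triv_scaleA x y c : triv_scale x (triv_scale y c) = triv_scale (x * y) c.
Proof. by rewrite /triv_scale rmorphM mulrA. Qed.

Lemma triv_scale1 : left_id 1 triv_scale.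
Proof. by move=> c; rewrite /triv_scale rmorph1 mul1r. Qed.

Lemma triv_scaleDr : right_distributive triv_scale +%R.
Proof. by move=> x c d; rewrite /triv_scale mulrDr. Qed.

Lemma triv_scaleDl c : {morph triv_scale^~ c : x y / x + y}.
Proof. by move=> x y; rewrite /triv_scale raddfD mulrDl. Qed.

HB.instance Definition _ := GRing.Zmodule_isLmodule.Build (group_ring R G) M
  triv_scaleA triv_scale1 triv_scaleDr triv_scaleDl.

Definition augmentation (v : 'rV[group_ring R G]_1) : M := gr_aug (v 0 0).

Lemma augmentation_linear : linear augmentation.
Proof.
move=> x u v; rewrite /augmentation !mxE raddfD.
by congr (_ + _); apply: rmorphM.
Qed.

HB.instance Definition _ := GRing.isLinear.Build (group_ring R G)
  'rV[group_ring R G]_1 M _ augmentation augmentation_linear.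

End TrivialModule.

(* The module in degree k is the left module of row vectors of length rk k, and
   d k, acting on the right of row vectors, is the differential from degree k + 1
   to degree k. *)
Definition is_free_resolution (A : nzRingType) (M : lmodType A)
    (rk : nat -> nat) (d : forall k, 'M[A]_(rk k.+1, rk k))
    (eps : {linear 'rV[A]_(rk 0%N) -> M}) : Prop :=
  [/\ forall y : M, exists v, eps v = y,
      forall v, eps v = 0 <-> exists w, v = w *m d 0%N
    & forall k (v : 'rV[A]_(rk k.+1)), v *m d k = 0 <-> exists w, v = w *m d k.+1].

(* The two generators a and b are indexed by false and true. *)
Definition triangle_relators (l m n : nat) : seq (word bool) :=
  let a := [:: (false, false)] in
  let b := [:: (true, false)] in
  [:: word_exp a l; word_exp b m; word_exp (a ++ b) n].

Definition triangle (l m n : nat) := presented (triangle_relators l m n).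
HB.instance Definition _ l m n := Group.on (triangle l m n).

Section TriangleResolution.
Context (l m n : nat).

Local Notation T := (triangle l m n).
Local Notation ZT := (group_ring int T).

Definition triangle_a : T := pgen (triangle_relators l m n) false.
Definition triangle_b : T := pgen (triangle_relators l m n) true.

Definition norm_elt (g : T) (k : nat) : ZT := \sum_(i < k.+1) gr_of int (g ^+ i)%g.

Definition mx_of_rows p q (rows : seq (seq ZT)) : 'M[ZT]_(p, q) :=
  \matrix_(i, j) (nth [::] rows i)`_j.

Local Notation a := (gr_of int triangle_a).
Local Notation b := (gr_of int triangle_b).
Local Notation Na := (norm_elt triangle_a l.-1).
Local Notation Nb := (norm_elt triangle_b m.-1).
Local Notation Nab := (norm_elt (triangle_a * triangle_b)%g n.-1).
Local Notation Nba := (norm_elt (triangle_b * triangle_a)%g n.-1).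

Definition partial1 : 'M[ZT]_(2, 1) :=
  mx_of_rows _ _ [:: [:: a - 1];
                     [:: b - 1]].

Definition partial2 : 'M[ZT]_(3, 2) :=
  mx_of_rows _ _ [:: [:: Na          ; 0           ];
                     [:: Nab         ; Nab * a - Nb];
                     [:: Nba * b - Na; Nba         ]].

Definition partial3 : 'M[ZT]_(3, 3) :=
  mx_of_rows _ _ [:: [:: a - 1; 0    ; 0        ];
                     [:: b - 1; 0    ; b * a - 1];
                     [:: 0    ; 1 - b; 1 - a    ]].

Definition partial4 : 'M[ZT]_(3, 3) :=
  mx_of_rows _ _ [:: [:: Na          ; 0           ; 0   ];
                     [:: Nab         ; Nab * a - Nb; - Nb];
                     [:: Nba * b - Na; Nba         ; 0   ]].

Definition triangle_rank (k : nat) : nat :=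
  match k with 0 => 1 | 1 => 2 | _ => 3 end.

(* [triangle_diff k] has source in degree k + 1: it is partial3 when k + 1 >= 3
   is odd and partial4 when k + 1 >= 4 is even. *)
Definition triangle_diff (k : nat) :
    'M[ZT]_(triangle_rank k.+1, triangle_rank k) :=
  match k with
  | 0 => partial1
  | 1 => partial2
  | j.+2 => if odd j.+3 then partial3 else partial4
  end.

End TriangleResolution.

(* Main.v *)
(** In the basis of relators [a^l], [b^m], [(ab)^n] the matrices [partial3] and
    [partial4] become the diagonal matrices of [g - 1] and of the norms [N_g] for
    [g = a, b, ab], and [partial2] becomes the matrix of Fox derivatives of the relators.
    Exactness in degrees 0 and 1 is Fox calculus and holds for any presentation; the
    diagonal matrices are exact because [g] has exact order [l], [m], [n] respectively.
    In degree 2, let [x Na + z Nab = 0] and [y Nb + z Nab a = 0].  Then [u = z Nab]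
    satisfies [u a = u] and [u a b = u a], so it is invariant under right multiplication
    by the whole group; as the group is infinite and [u] has finite support, [u = 0], and
    the kernel is again the one of a diagonal matrix.

    Orders and infinitude are read off a homomorphism to PSL_2(R) sending [a], [b], [ab]
    to elliptic elements of angles pi/l, pi/m, pi/n; hyperbolicity makes the trace of the
    commutator exceed 2, so that its image has infinite order. *)
Require Import Defs.
From HB Require Import structures.
From mathcomp Require Import all_boot all_order all_algebra fingroup.
From mathcomp Require Import finmap generic_quotient.
From mathcomp.multinomials Require Import monalg.
From mathcomp Require Import Rstruct reals trigo.
From mathcomp Require Import ring lra.

Set Implicit Arguments.
Unset Strict Implicit.
Unset Printing Implicit Defensive.

Import Order.TTheory GRing.Theory Num.Theory.
Local Open Scope ring_scope.

(** * Integral group rings as free abelian groups *)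

Section IntegralGroupRing.
Context (G : groupType).
Local Notation ZG := (group_ring int G).
Local Notation gr := (@gr_of int G).
Implicit Types (x y z : ZG) (g h t : G).

Lemma gr_ofM g h : gr (g * h)%g = gr g * gr h.
Proof. by rewrite !gr_ofE; apply/esym/(etrans (gr_mulUU 1 1 g h)); rewrite mul1r. Qed.

Lemma gr_ofX g k : gr (g ^+ k)%g = gr g ^+ k.
Proof. by elim: k => [|k IHk] //; rewrite expgS gr_ofM IHk exprS. Qed.

Lemma geometric_mulr x k : (\sum_(i < k) x ^+ i) * (x - 1) = x ^+ k - 1.
Proof.
elim: k => [|k IHk]; first by rewrite big_ord0 mul0r subrr.
rewrite big_ord_recr /= mulrDl IHk mulrBr mulr1 -exprSr.
by rewrite addrC addrA subrK.
Qed.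

Lemma gr_aug_of g : gr_aug (gr g) = 1.
Proof. by rewrite gr_ofE gr_augU. Qed.

(** The group elements generate [ZG] additively, so closure under subtraction suffices. This is the
    induction principle for additive statements below. *)
Lemma gr_span (P : ZG -> Prop) :
  (forall x y, P x -> P y -> P (x - y)) -> (forall g, P (gr g)) -> forall x, P x.
Proof.
move=> PB Pg; have P0 : P 0 by rewrite -(subrr (gr 1%g)); apply: PB.
have PN x : P x -> P (- x) by rewrite -[- x]sub0r; apply: PB.
have PD x y : P x -> P y -> P (x + y).
  by move=> Px Py; rewrite -[y]opprK; apply: PB (PN _ _).
apply: gr_ind => // c g.
have -> : mkmalgU g c = gr g *~ c :> ZG.
  have UMn n : mkmalgU g n%:Z = gr g *+ n :> ZG.
    elim: n => [|n IHn]; first by rewrite monalgU0.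
    by rewrite mulrS -IHn gr_ofE -monalgUD -intS.
  case: c => n; first exact: UMn.
  by rewrite NegzE mulrNz -[_ *~ _]UMn monalgUN.
have PMn n : P (gr g *+ n) by elim: n => // n IHn; rewrite mulrS; apply: PD.
by case: c => n; [apply: PMn | apply/PN/PMn].
Qed.

Lemma mcoeff_gr_of g h : mcoeff h (gr g) = (g == h)%:R.
Proof. by rewrite gr_ofE mcoeffU; case: eqP. Qed.

Lemma mcoeff_mul_of x g t : mcoeff t (x * gr g) = mcoeff (t * g^-1)%g x.
Proof.
elim/gr_span: x => [x y IHx IHy|h]; first by rewrite mulrBl !mcoeffB IHx IHy.
rewrite -gr_ofM !mcoeff_gr_of; congr ((nat_of_bool _)%:R).
by apply/eqP/eqP => [<-|->]; rewrite ?mulgK ?mulgKV.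
Qed.

(** The additive extension of [f] given by the universal property of [ZG] as the free abelian group
    on [G]. *)
Definition gr_extend (V : zmodType) (f : G -> V) (x : ZG) : V :=
  \sum_(g <- msupp x) f g *~ mcoeff g x.

Lemma gr_extendEw (V : zmodType) (f : G -> V) (d : {fset G}) x :
  (msupp x `<=` d)%fset -> gr_extend f x = \sum_(g <- d) f g *~ mcoeff g x.
Proof.
move=> le; rewrite /gr_extend (big_fset_incl _ le) //= => g _ /mcoeff_outdom ->.
by rewrite mulr0z.
Qed.

Lemma gr_extendB (V : zmodType) (f : G -> V) : zmod_morphism (gr_extend f).
Proof.
move=> x y; pose d := (msupp x `|` msupp y)%fset.
rewrite !(@gr_extendEw _ f d) ?fsubsetUl ?fsubsetUr //.
  by rewrite -sumrB; apply: eq_bigr => g _; rewrite mcoeffB mulrzBr.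
by apply: fsubset_trans (msuppD_le _ _) _; rewrite msuppN.
Qed.

HB.instance Definition _ (V : zmodType) (f : G -> V) :=
  GRing.isZmodMorphism.Build ZG V (gr_extend f) (gr_extendB f).

Lemma gr_extend_of (V : zmodType) (f : G -> V) g : gr_extend f (gr g) = f g.
Proof.
rewrite (@gr_extendEw _ f [fset g]%fset); last by rewrite gr_ofE msuppU_le.
by rewrite big_seq_fset1 mcoeff_gr_of eqxx mulr1z.
Qed.

(** * Annihilators of the norm and of [g - 1] for [g] of finite order *)

Section Cyclic.
Context (g : G) (k : nat).
Hypothesis g_expg : (g ^+ k.+1 = 1)%g.

Local Notation N := (\sum_(i < k.+1) gr (g ^+ i)%g).

Lemma norm_mulr : N * gr g = N.
Proof.
rewrite mulr_suml big_ord_recr big_ord_recl /= -gr_ofM -expgSr g_expg addrC.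
by congr (_ + _); apply: eq_bigr => i _; rewrite -gr_ofM -expgSr.
Qed.

Lemma norm_mull : gr g * N = N.
Proof.
rewrite mulr_sumr -[RHS]norm_mulr mulr_suml.
by apply: eq_bigr => i _; rewrite -!gr_ofM -expgS -expgSr.
Qed.

Hypothesis g_order : forall i, (0 < i <= k)%N -> (g ^+ i != 1)%g.

Lemma expg_inj_ord (i j : 'I_k.+1) : (g ^+ i = g ^+ j)%g -> i = j.
Proof.
wlog le_ij : i j / (i <= j)%N.
  by move=> H; case/orP: (leq_total i j) => [|ji]; [apply: H | move/esym/(H j i ji)].
move=> eq_ij; apply/val_inj/eqP; rewrite /= eqn_leq le_ij /= leqNgt; apply/negP => lt_ij.
have := @g_order (j - i); rewrite subn_gt0 lt_ij /= => /(_ _)/eqP; apply.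
  by rewrite (leq_trans (leq_subr _ _)) // -ltnS.
by apply: (mulgI (g ^+ i)%g); rewrite -expgD subnKC // mulg1 eq_ij.
Qed.

Definition in_coset h : pred G := fun t => [exists i : 'I_k.+1, t == h * g ^+ i]%g.
(** A transversal of the left cosets of the powers of [g]: [choose] depends only on the coset as a
    predicate, so the representative is constant on it. *)
Definition coset_rep h := choose (in_coset h) h.

Lemma coset_repP h : exists i : 'I_k.+1, coset_rep h = (h * g ^+ i)%g.
Proof.
have : in_coset h (coset_rep h).
  by apply: chooseP; apply/existsP; exists ord0; rewrite mulg1.
by case/existsP => i /eqP; exists i.
Qed.

Lemma coset_rep_mulr h : coset_rep (h * g)%g = coset_rep h.
Proof.
have eqP : in_coset (h * g)%g =1 in_coset h.
  move=> t; apply/existsP/existsP => -[i /eqP ->].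
    case: (ltngtP i k) (ltn_ord i) => [ik _|ki|ik _]; last 1 first.
    - by exists ord0; rewrite ik -mulgA -expgS g_expg.
    - by exists (Ordinal (ik : i.+1 < k.+1)%N); rewrite /= -mulgA -expgS.
    by rewrite ltnS leqNgt ki.
  case: i => [[|i] lti] /=.
    by exists ord_max; rewrite /= -mulgA -expgS g_expg.
  by exists (Ordinal (ltnW lti)); rewrite /= -mulgA -expgS.
rewrite /coset_rep (eq_choose eqP); apply: choose_id.
  rewrite -eqP; apply/existsP; exists ord0; by rewrite mulg1.
by apply/existsP; exists ord0; rewrite mulg1.
Qed.

Lemma coset_rep_mulXr h i : coset_rep (h * g ^+ i)%g = coset_rep h.
Proof.
by elim: i => [|i IHi]; rewrite ?mulg1 // expgSr mulgA coset_rep_mulr.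
Qed.

Local Notation rep_part := (gr_extend (fun h => if coset_rep h == h then gr h else 0)).

(** [h * N] is the sum over the coset of [h]; as the powers of [g] are distinct, the representative
    occurs in it exactly once, and [rep_part] keeps only that term. *)
Lemma rep_part_mul_norm x : rep_part (x * N) = gr_extend (fun h => gr (coset_rep h)) x.
Proof.
elim/gr_span: x => [x y IHx IHy|h]; first by rewrite mulrBl !raddfB /= IHx IHy.
rewrite gr_extend_of mulr_sumr raddf_sum.
have [j def_j] := coset_repP h.
rewrite (bigD1 j) //= big1 ?addr0 => [|i neq_ij].
  by rewrite /= -gr_ofM gr_extend_of coset_rep_mulXr def_j eqxx.
rewrite /= -gr_ofM gr_extend_of coset_rep_mulXr def_j.
by case: eqP => // /mulgI/expg_inj_ord eq_ji; rewrite eq_ji eqxx in neq_ij.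
Qed.

(** By the geometric sum, every [h] is congruent to its coset representative modulo left multiples
    of [g - 1]. So [x] is congruent to its image under [coset_rep], which vanishes once
    [x * N = 0]. *)
Lemma mul_norm_eq0 x : x * N = 0 <-> exists y, x = y * (gr g - 1).
Proof.
split=> [xN|[y ->]]; last by rewrite -mulrA mulrBl norm_mull mul1r subrr mulr0.
have: gr_extend (fun h => gr (coset_rep h)) x = 0.
  by rewrite -rep_part_mul_norm xN raddf0.
have [y def_y] : exists y, gr_extend (fun h => gr (coset_rep h)) x - x = y * (gr g - 1).
  elim/gr_span: x {xN} => [x y [u ux] [v vy]|h].
    by exists (u - v); rewrite raddfB /= mulrBl -ux -vy opprD addrACA -!opprD.
  rewrite gr_extend_of; have [i ->] := coset_repP h.
  exists (gr h * \sum_(j < i) gr g ^+ j).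
  by rewrite gr_ofM gr_ofX -mulrA geometric_mulr mulrBr mulr1.
by move=> x0; exists (- y); rewrite mulNr -def_y x0 sub0r opprK.
Qed.

(** If [x * g = x], the coefficients of [x] are constant on cosets, so [x] is recovered from its
    coefficients at the representatives as [rep_part x * N]. *)
Lemma mul_sub1_eq0 x : x * (gr g - 1) = 0 <-> exists y, x = y * N.
Proof.
split=> [xg|[y ->]]; last by rewrite -mulrA mulrBr norm_mulr mulr1 subrr mulr0.
have {}xg : x * gr g = x by apply/eqP; rewrite -subr_eq0 -{2}[x]mulr1 -mulrBr xg.
have xgV i t : mcoeff (t * (g ^+ i)^-1)%g x = mcoeff t x.
  elim: i t => [|i IHi] t; first by rewrite invg1 mulg1.
  by rewrite expgS invgM mulgA -mcoeff_mul_of xg IHi.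
have rep_coeff t : mcoeff t (rep_part x) = mcoeff t x * (coset_rep t == t)%:R.
  elim/gr_span: x {xg xgV} => [x y IHx IHy|h].
    by rewrite raddfB !mcoeffB /= IHx IHy mulrBl.
  rewrite gr_extend_of mcoeff_gr_of; case: eqP => [rep_h|norep_h].
    rewrite mcoeff_gr_of; case: eqP => [<-|]; last by rewrite mul0r.
    by rewrite rep_h eqxx.
  rewrite mcoeff0; case: (h =P t) => [<-|]; last by rewrite mul0r.
  by case: eqP.
exists (rep_part x); apply/malgP => t; rewrite mulr_sumr raddf_sum /=.
have [j def_j] := coset_repP t.
(* The exponent of the inverse of [g ^+ j]; the reduction modulo [k.+1] matters for [j = 0]. *)
pose j' : 'I_k.+1 := inord ((k.+1 - j) %% k.+1).
have j'E : (g ^+ j' = (g ^+ j)^-1)%g.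
  apply: (mulgI (g ^+ j)%g); rewrite mulgV inordK ?ltn_mod //.
  case: (posnP j) => [->|j_gt0]; first by rewrite subn0 modnn mulg1.
  by rewrite modn_small ?ltn_subrL ?j_gt0 // -expgD subnKC // ltnW.
have repV i : coset_rep (t * (g ^+ i)^-1)%g = coset_rep t.
  by rewrite -(coset_rep_mulXr _ i) mulgKV.
rewrite (bigD1 j') //= big1 ?addr0 => [|i neq_ij].
  by rewrite mcoeff_mul_of rep_coeff xgV repV def_j j'E invgK eqxx mulr1.
rewrite mcoeff_mul_of rep_coeff repV def_j.
case: eqP => [/mulgI eq_j|]; last by rewrite mulr0.
by case/eqP: neq_ij; apply: expg_inj_ord; rewrite j'E eq_j invgK.
Qed.

End Cyclic.

(* The support of x is stable under right translation by h, hence infinite if nonempty. *)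
Lemma right_invariant_eq0 h x :
  (forall i, (h ^+ i.+1 != 1)%g) -> x * gr h = x -> x = 0.
Proof.
move=> h_inf xh; apply/malgP => t; rewrite mcoeff0; apply: contraTeq isT => xt.
have xhX i : mcoeff (t * (h ^+ i)^-1)%g x = mcoeff t x.
  elim: i t {xt} => [|i IHi] t; first by rewrite invg1 mulg1.
  by rewrite expgS invgM mulgA -mcoeff_mul_of xh IHi.
pose f (i : 'I_#|` msupp x|.+1) := (t * (h ^+ i)^-1)%g.
have f_inj : injective f.
  by move=> i j /mulgI/invg_inj/expg_inj_ord; apply=> -[].
have := @uniq_leq_size _ [seq f i | i <- enum 'I__] (msupp x).
rewrite size_map size_enum_ord ltnn => le_size; apply: le_size.
  by rewrite map_inj_uniq // enum_uniq.
by move=> _ /mapP[i _ ->]; rewrite -mcoeff_neq0 xhX.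
Qed.

End IntegralGroupRing.

(** * Elliptic pairs in SL_2(R) for a hyperbolic triangle *)

Section TriangleRepresentation.
Context (R : realType).
Local Notation Mat := 'M[R]_2.
Implicit Types (M N : Mat) (x y z w : R).

Definition mx2 x y z w : Mat :=
  \matrix_(i, j) if i == 0 then (if j == 0 then x else y) else if j == 0 then z else w.

Lemma mx2P M N : M 0 0 = N 0 0 -> M 0 1 = N 0 1 -> M 1 0 = N 1 0 -> M 1 1 = N 1 1 -> M = N.
Proof.
move=> e00 e01 e10 e11; apply/matrixP => i j.
have ord2P (k : 'I_2) : k = 0 \/ k = 1.
  by case: k => [[|[|k]] ltk] //; [left | right]; apply: val_inj.
by case: (ord2P i) => ->; case: (ord2P j) => ->.
Qed.

Lemma mulmx2E M N i j : (M * N) i j = M i 0 * N 0 j + M i 1 * N 1 j.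
Proof.
rewrite mxE !big_ord_recl big_ord0 addr0.
by congr (_ + M i _ * N _ j); apply: val_inj.
Qed.

(** Cayley-Hamilton in determinant 1. *)
Lemma mx2_sqr M : M 0 0 * M 1 1 - M 0 1 * M 1 0 = 1 ->
  M * M = (M 0 0 + M 1 1) *: M - 1.
Proof.
move=> det1; apply: mx2P; rewrite mulmx2E !mxE /= ?mulr1n ?mulr0n -?det1; ring.
Qed.

(** The coefficients are Chebyshev polynomials of the second kind at [cos x], multiplied by [sin x]
    to clear the denominator. *)
Lemma chebyshev M x k : M * M = (2 * cos x) *: M - 1 ->
  sin x *: M ^+ k.+1 = sin (x *+ k.+1) *: M - (sin (x *+ k))%:A.
Proof.
move=> M2; elim: k => [|k IHk]; first by rewrite mulr0n sin0 scale0r subr0.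
rewrite exprS scalerAr IHk mulrBr -!scalerAr M2 mulr1 scalerBr scalerA addrAC -scalerBl.
congr (_ *: M - _).
rewrite !mulrS; set y := x *+ k; rewrite !sinD !cosD.
have := cos2Dsin2 x; move: (sin x) (cos x) (sin y) (cos y) => s c s' c' /(congr1 ( *%R s')); lra.
Qed.

(** Triviality in PSL_2(R), stated without forming the quotient. *)
Definition pm1 (r : Mat) := r = 1 \/ r = -1.

(** With [x = pi / k], [chebyshev] at [k] gives [-1]. For [0 < i < k] the factor [sin (x *+ i)] is
    nonzero, so [M ^+ i = 1] or [-1] would make [M] scalar. *)
Lemma half_turn M k : (2 <= k)%N -> M * M = (2 * cos (pi / k%:R)) *: M - 1 ->
  M ^+ k = -1 /\ forall i, (0 < i < k)%N -> ~ pm1 (M ^+ i).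
Proof.
move=> k_ge2 M2; set x := pi / k%:R in M2.
have k_gt0 : 0 < k%:R :> R by rewrite ltr0n; apply: leq_trans k_ge2.
have sin_gt0 i : (0 < i < k)%N -> 0 < sin (x *+ i).
  case/andP=> i_gt0 ltik; apply: sin_gt0_pi; rewrite pmulrn_lgt0 ?divr_gt0 ?pi_gt0 //=.
  by rewrite -mulr_natr mulrAC ltr_pdivrMr // ltr_pM2l ?pi_gt0 // ltr_nat.
have sinx : 0 < sin x by rewrite -[x]mulr1n sin_gt0.
have x_k : x *+ k = pi by rewrite -mulr_natr divfK ?gt_eqF.
split.
  have := chebyshev k.-1 M2; rewrite prednK ?(leq_trans _ k_ge2) // x_k sinpi scale0r sub0r.
  have -> : x *+ k.-1 = pi - x.
    by rewrite -x_k -[in RHS](prednK (ltnW k_ge2)) mulrSr addrK.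
  rewrite sinB sinpi cospi mul0r sub0r mulN1r opprK => eq_sin.
  by apply: (scalerI (lt0r_neq0 sinx)); rewrite eq_sin scalerN.
move=> i /andP[i_gt0 lt_ik] pm1_Mi.
have [c McE] : exists c, M = c%:A.
  have := chebyshev i.-1 M2; rewrite prednK // => /(canLR (subrK _))/esym.
  have [d ->] : exists d, M ^+ i = d%:A.
    by case: pm1_Mi => ->; [exists 1 | exists (-1)]; rewrite ?scaleNr scale1r.
  rewrite scalerA -scalerDl => /(congr1 ( *:%R (sin (x *+ i))^-1)).
  rewrite !scalerA mulVf ?scale1r ?gt_eqF ?sin_gt0 ?i_gt0 // => ->.
  by eexists.
(* A scalar [c] would satisfy [(c - cos x)^2 + (sin x)^2 = 0], while [sin x > 0]. *)
move: (congr1 (fun N : Mat => N 0 0) M2); rewrite McE mulmx2E !mxE /= !mulr1n.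
have := cos2Dsin2 x; have := mulr_gt0 sinx sinx; have := sqr_ge0 (c - cos x); lra.
Qed.

(** By Cayley-Hamilton the traces of the powers satisfy a two-term recurrence, which makes them
    increase strictly from 2; the matrices 1 and -1 have traces 2 and -2. *)
Lemma trace_gt2_expr M k : M 0 0 * M 1 1 - M 0 1 * M 1 0 = 1 -> 2 < M 0 0 + M 1 1 ->
  ~ pm1 (M ^+ k.+1).
Proof.
move=> det1 tr_gt2; pose t i := (M ^+ i) 0 0 + (M ^+ i) 1 1.
have tS i : t i.+2 = (M 0 0 + M 1 1) * t i.+1 - t i.
  rewrite /t !exprS mulrA mx2_sqr // mulrBl mul1r -scalerAl !mxE.
  rewrite -?exprS; ring.
have t_gt i : 2 <= t i /\ t i < t i.+1.
  elim: i => [|i [IH1 IH2]]; first by rewrite /t expr0 expr1 !mxE /= mulr1n; split; lra.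
  by rewrite tS; split; [lra | nra].
have [t_ge2] := t_gt k; rewrite [X in _ < X]/t.
by move=> t_lt [] Mk; move: t_lt; rewrite Mk !mxE /= ?mulr1n; lra.
Qed.

Lemma mx2_inv x y z : x * x + y * z = 1 -> mx2 x y (- z) x * mx2 x (- y) z x = 1.
Proof. by move=> eq1; apply: mx2P; rewrite mulmx2E !mxE /= ?mulr1n ?mulr0n -?eq1; ring. Qed.

Lemma det2_mul M N (d := fun K : Mat => K 0 0 * K 1 1 - K 0 1 * K 1 0) :
  d (M * N) = d M * d N.
Proof. rewrite /d !mulmx2E; ring. Qed.

Definition half_turn_pair (l m n : nat) (A A' B B' : Mat) :=
  [/\ A * A' = 1 /\ A' * A = 1, B * B' = 1 /\ B' * B = 1,
      A ^+ l = -1 /\ forall i, (0 < i < l)%N -> ~ pm1 (A ^+ i),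
      B ^+ m = -1 /\ forall i, (0 < i < m)%N -> ~ pm1 (B ^+ i)
    & pm1 ((A * B) ^+ n) /\ forall i, (0 < i < n)%N -> ~ pm1 ((A * B) ^+ i)].

Lemma pm1N M k : pm1 ((- M) ^+ k) <-> pm1 (M ^+ k).
Proof.
rewrite exprNn -signr_odd /pm1; case: (odd k); rewrite ?expr0 ?expr1 ?mul1r //.
rewrite mulN1r; split=> -[] Mk; [right|left|right|left]; rewrite ?Mk ?opprK //.
  by rewrite -Mk opprK.
by apply: oppr_inj.
Qed.

(* A is the rotation by pi/l and B the rotation by pi/m conjugated by a diagonal matrix
   with ratio t, where t + 1/t = w is dictated by tr (A B) = - 2 cos (pi/n).  Hyperbolicity
   is the inequality w > 2, and the trace of the commutator of A and B is
   2 + ((t - 1/t) sin (pi/l) sin (pi/m))^2. *)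
Lemma hyperbolic_half_turns (l m n : nat) : (2 <= l)%N -> (2 <= m)%N -> (2 <= n)%N ->
  l%:R^-1 + m%:R^-1 + n%:R^-1 < 1 :> R ->
  exists A A' B B' : Mat, half_turn_pair l m n A A' B B' /\
    forall k, ~ pm1 ((A * B * A' * B') ^+ k.+1).
Proof.
move=> l_ge2 m_ge2 n_ge2 hyp.
have angle_gt0 k : (2 <= k)%N -> 0 < (pi : R) / k%:R < (pi : R).
  move=> k_ge2; have k_gt0 : 0 < k%:R :> R by rewrite ltr0n ltnW.
  by rewrite divr_gt0 ?pi_gt0 //= ltr_pdivrMr // ltr_pMr ?pi_gt0 // ltr1n.
have /andP[al_gt0 al_ltpi] := angle_gt0 l l_ge2.
have /andP[be_gt0 be_ltpi] := angle_gt0 m m_ge2.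
have /andP[ga_gt0 ga_ltpi] := angle_gt0 n n_ge2.
set al := pi / l%:R in al_gt0 al_ltpi; set be := pi / m%:R in be_gt0 be_ltpi.
set ga := pi / n%:R in ga_gt0 ga_ltpi.
have sum_ltpi : al + be + ga < pi.
  by rewrite -!mulrDr -[ltRHS]mulr1 ltr_pM2l ?pi_gt0.
(* Since [al + be < pi - ga] and the cosine decreases on [0, pi]; divided by [sin al * sin be], this
   becomes [w > 2]. *)
have cos_sum : 0 < cos ga + cos (al + be).
  have -> : cos ga = - cos (pi - ga) by rewrite cosB cospi sinpi; ring.
  rewrite addrC subr_gt0 ltr_cos ?in_itv /=; lra.
have sa_gt0 : 0 < sin al by apply: sin_gt0_pi; rewrite al_gt0.
have sb_gt0 : 0 < sin be by apply: sin_gt0_pi; rewrite be_gt0.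
rewrite cosD in cos_sum.
pose w := 2 * (cos ga + cos al * cos be) / (sin al * sin be).
have w_gt2 : 2 < w.
  by rewrite /w ltr_pdivlMr ?mulr_gt0 // ltr_pM2l // -subr_gt0; move: cos_sum; lra.
have w_def : w * (sin al * sin be) = 2 * (cos ga + cos al * cos be).
  by rewrite /w divfK // gt_eqF ?mulr_gt0.
have [t [u [tu1 tDu]]] : exists t u, t * u = 1 /\ t + u = w.
  exists ((w + Num.sqrt (w ^+ 2 - 4)) / 2), ((w - Num.sqrt (w ^+ 2 - 4)) / 2).
  have : Num.sqrt (w ^+ 2 - 4) ^+ 2 = w ^+ 2 - 4 by rewrite sqr_sqrtr; nra.
  by move: (Num.sqrt _) => s s2; split; lra.
have det_al := cos2Dsin2 al; have det_be := cos2Dsin2 be.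
pose A := mx2 (cos al) (sin al) (- sin al) (cos al).
pose A' := mx2 (cos al) (- sin al) (sin al) (cos al).
pose B := mx2 (cos be) (t * sin be) (- (u * sin be)) (cos be).
pose B' := mx2 (cos be) (- (t * sin be)) (u * sin be) (cos be).
exists A, A', B, B'.
have detA : A 0 0 * A 1 1 - A 0 1 * A 1 0 = 1 by rewrite !mxE /=; lra.
have detA' : A' 0 0 * A' 1 1 - A' 0 1 * A' 1 0 = 1 by rewrite !mxE /=; lra.
have tu_sin : t * u * (sin be * sin be) = sin be * sin be by rewrite tu1 mul1r.
have detB : B 0 0 * B 1 1 - B 0 1 * B 1 0 = 1 by rewrite !mxE /=; lra.
have detB' : B' 0 0 * B' 1 1 - B' 0 1 * B' 1 0 = 1 by rewrite !mxE /=; lra.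
have detC : (A * B) 0 0 * (A * B) 1 1 - (A * B) 0 1 * (A * B) 1 0 = 1.
  by rewrite det2_mul detA detB mulr1.
have det_comm : (A * B * A' * B') 0 0 * (A * B * A' * B') 1 1
  - (A * B * A' * B') 0 1 * (A * B * A' * B') 1 0 = 1.
  by rewrite !det2_mul detA detB detA' detB' !mulr1.
have trC : (A * B) 0 0 + (A * B) 1 1 = - (2 * cos ga).
  by rewrite !mulmx2E !mxE /=; move: w_def; rewrite -tDu; lra.
split.
  split.
  - split; first by apply: mx2_inv; lra.
    by have := @mx2_inv (cos al) (- sin al) (- sin al); rewrite !opprK; apply; lra.
  - split; first by apply: mx2_inv; lra.
    by have := @mx2_inv (cos be) (- (t * sin be)) (- (u * sin be)); rewrite !opprK; apply; lra.
  - apply: half_turn => //; rewrite mx2_sqr //; congr (_ *: _ - 1).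
    by rewrite !mxE /=; ring.
  - apply: half_turn => //; rewrite mx2_sqr //; congr (_ *: _ - 1).
    by rewrite !mxE /=; ring.
  (* The trace of [A * B] has the opposite sign to the one [half_turn] asks for; [pm1] does not see
     the sign. *)
  have [Cn Ci] : (- (A * B)) ^+ n = -1 /\
      forall i, (0 < i < n)%N -> ~ pm1 ((- (A * B)) ^+ i).
    by apply: half_turn => //; rewrite mulrNN mx2_sqr // trC scaleNr -scalerN.
  split; first by apply/pm1N; right.
  by move=> i /Ci Ni /pm1N.
move=> k; apply: trace_gt2_expr => //.
(* Keeping [det (A * B)] in place of 1 makes this a polynomial identity. *)
have -> : (A * B * A' * B') 0 0 + (A * B * A' * B') 1 1 =
    ((t - u) * (sin al * sin be)) ^+ 2 +
    2 * ((A * B) 0 0 * (A * B) 1 1 - (A * B) 0 1 * (A * B) 1 0).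
  by rewrite -[A * B * A' * B']mulrA !mulmx2E !mxE /=; ring.
rewrite detC mulr1 ltrDr exprn_even_gt0 //= mulf_neq0 //; last by rewrite gt_eqF ?mulr_gt0.
apply/eqP => /eqP; rewrite subr_eq0 => /eqP t_eq_u.
by move: w_gt2 tu1; rewrite -tDu t_eq_u => u_gt1 uu1; nra.
Qed.

End TriangleRepresentation.

(** * Words, evaluation up to sign and Fox calculus for any presentation *)

Section PresentedGroup.
Context (I : choiceType) (rels : seq (word I)).
Local Notation T := (presented rels).
Local Notation cls := (@pclass I rels).
Local Notation gen := (@pgen I rels).
Local Notation ZT := (group_ring int T).
Local Notation gr := (@gr_of int T).
Implicit Types u v w : word I.

Lemma pclass_cat u v : cls (u ++ v) = (cls u * cls v)%g.
Proof. exact/esym/pmulE. Qed.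

Lemma pclass_cons c u : cls (c :: u) = (cls [:: c] * cls u)%g.
Proof. by rewrite -pclass_cat. Qed.

Lemma pclass_exp u k : cls (word_exp u k) = (cls u ^+ k)%g.
Proof. by elim: k => [|k IHk] //; rewrite /word_exp /= pclass_cat IHk expgS. Qed.

Lemma pclass_pgenV x : cls [:: (x, true)] = (gen x)^-1%g.
Proof.
apply: (mulgI (gen x)); rewrite mulgV -pclass_cat.
by apply/pclassP; apply: (WeqCancel rels x false).
Qed.

Lemma pclass_rel r : r \in rels -> cls r = 1%g.
Proof. by move=> r_rel; apply/pclassP/WeqRel. Qed.

(** Von Dyck's theorem modulo signs: since -1 is central, relators need only evaluate to 1 or -1. *)
Lemma word_eq_eval_sign (S : nzRingType) (f : I * bool -> S) :
    (forall x e, f (x, e) * f (x, ~~ e) = 1) ->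
    (forall r, r \in rels -> exists s : bool, \prod_(c <- r) f c = (-1) ^+ s) ->
  forall u v, word_eq rels u v ->
  exists s : bool, \prod_(c <- u) f c = (-1) ^+ s * \prod_(c <- v) f c.
Proof.
move=> fV frel u v; elim=> {u v} [u|u v _ [s ->]|u v w _ [s ->] _ [s' ->]|||r r_rel].
- by exists false; rewrite mul1r.
- by exists s; rewrite signrMK.
- by exists (s (+) s'); rewrite mulrA signr_addb.
- move=> u u' v v' _ [s us] _ [s' vs]; exists (s (+) s').
  rewrite !big_cat /= us vs signr_addb -!mulrA; congr (_ * _).
  by rewrite !mulrA; congr (_ * _); apply: commr_sign.
- by move=> x e; exists false; rewrite !big_cons !big_nil !mulr1 fV.
have [s rs] := frel r r_rel.
by exists s; rewrite rs big_nil mulr1.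
Qed.

Lemma prod_word_exp (S : nzRingType) (f : I * bool -> S) u k :
  \prod_(c <- word_exp u k) f c = (\prod_(c <- u) f c) ^+ k.
Proof.
elim: k => [|k IHk]; first by rewrite big_nil.
by rewrite /word_exp /= big_cat /= -/(word_exp u k) IHk exprS.
Qed.

Section FoxCalculus.
Context (V : lmodType ZT) (e : I -> V).

Definition fox_letter (c : I * bool) : V :=
  if c.2 then - (gr (gen c.1)^-1%g *: e c.1) else e c.1.

(** The total Fox derivative, with coefficients already mapped to the group ring of the presented
    group. It obeys [d(uv) = du + u dv], and [fox_letter] is forced by [d(x x^-1) = 0]. *)
Fixpoint fox u : V :=
  if u is c :: u' then fox_letter c + gr (cls [:: c]) *: fox u' else 0.

Lemma fox_cat u v : fox (u ++ v) = fox u + gr (cls u) *: fox v.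
Proof.
elim: u => [|c u IHu] /=; first by rewrite add0r scale1r.
by rewrite IHu [cls (c :: u)]pclass_cons gr_ofM -scalerA scalerDr addrA.
Qed.

Lemma fox_exp u k : fox (word_exp u k) = (\sum_(i < k) gr (cls u ^+ i)%g) *: fox u.
Proof.
elim: k => [|k IHk]; first by rewrite big_ord0 scale0r.
rewrite /word_exp /= -/(word_exp u k) fox_cat IHk big_ord_recl scalerDl scale1r scalerA.
congr (_ + _ *: _); rewrite mulr_sumr; apply: eq_bigr => i _.
by rewrite -gr_ofM -expgS.
Qed.

Context (S : V -> Prop).
Hypothesis S0 : S 0.
Hypothesis SD : forall x y, S x -> S y -> S (x + y).
Hypothesis SZ : forall r x, S x -> S (r *: x).
Hypothesis Srel : forall r, r \in rels -> S (fox r).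

Let SN x : S x -> S (- x).
Proof. by rewrite -scaleN1r; apply: SZ. Qed.

(** For a submodule [S] containing the derivatives of the relators, the product rule makes [fox]
    well defined on group elements modulo [S]. *)
Lemma fox_word_eq u v : word_eq rels u v -> S (fox u - fox v).
Proof.
elim=> {u v} [u|u v _|u v w _ Suv _ Svw|u u' v v' uu' Su _ Sv|x b|r r_rel].
- by rewrite subrr.
- by move/SN; rewrite opprB.
- by rewrite -(subrK (fox v) (fox u)) -addrA; apply: SD.
- rewrite !fox_cat; move/pclassP: uu' => ->.
  by rewrite opprD addrACA -scalerBr; apply: SD => //; apply: SZ.
- rewrite /= scaler0 !addr0 subr0 /fox_letter.
  case: b => /=; last by rewrite scalerN scalerA -gr_ofM mulgV scale1r subrr.
  by rewrite pclass_pgenV addNr.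
by rewrite subr0; apply: Srel.
Qed.

(* g |-> fox (repr g) is a derivation modulo S, so x * (gen i - 1) is sent to x *: e i. *)
Lemma fox_mul_sub1 (x : ZT) i :
  S (gr_extend (fun g : T => fox (repr g)) (x * (gr (gen i) - 1)) - x *: e i).
Proof.
elim/gr_span: x => [x y Sx Sy|g].
  by rewrite mulrBl raddfB scalerBl opprD addrACA -opprD; apply: SD => //; apply: SN.
rewrite mulrBr mulr1 -gr_ofM raddfB /= !gr_extend_of.
have -> : gr g *: e i = fox (repr g ++ [:: (i, false)]) - fox (repr g).
  by rewrite fox_cat /= scaler0 addr0 pclassK addrC addKr.
rewrite opprB addrA subrK; apply: fox_word_eq; apply/pclassP.
by rewrite pclass_cat !pclassK.
Qed.

End FoxCalculus.

(** The fundamental formula of Fox calculus; it follows from the product rule by telescoping. *)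
Lemma fox_boundary (V W : lmodType ZT) (e : I -> V) (f : {linear V -> W}) z :
  (forall i, f (e i) = (gr (gen i) - 1) *: z) ->
  forall u, f (fox e u) = (gr (cls u) - 1) *: z.
Proof.
move=> fe; elim=> [|c u IHu]; first by rewrite linear0 subrr scale0r.
rewrite /= linearD linearZ /= IHu [cls (c :: u)]pclass_cons gr_ofM.
have -> : f (fox_letter e c) = (gr (cls [:: c]) - 1) *: z.
  case: c => x [] /=; last by rewrite fe.
  rewrite linearN linearZ /= fe pclass_pgenV scalerA mulrBr mulr1 -gr_ofM mulVg.
  by rewrite -scaleNr opprB.
by rewrite scalerA -scalerDl mulrBr [_ * 1]mulr1 addrC addrA subrK.
Qed.

End PresentedGroup.

(** * Exactness of matrix pairs under change of bases and for diagonal matrices *)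

Section MatrixExactness.
Context (A : nzRingType).

Definition mx_exact p q r (M : 'M[A]_(q, p)) (N : 'M[A]_(r, q)) :=
  forall v : 'rV_q, v *m M = 0 <-> exists w, v = w *m N.

Definition mx_inverse p (X Y : 'M[A]_p) := X *m Y = 1%:M /\ Y *m X = 1%:M.

Lemma mx_exact_base_change p q r (M M' : 'M[A]_(q, p)) (N N' : 'M[A]_(r, q)) X Xi Y Yi Z Zi :
    mx_inverse X Xi -> mx_inverse Y Yi -> mx_inverse Z Zi ->
    M *m X = Y *m M' -> N *m Y = Z *m N' ->
  mx_exact M' N' -> mx_exact M N.
Proof.
move=> [XXi _] [YYi YiY] [ZZi ZiZ] MX NY exM'N' v.
have vM0 : v *m M = 0 <-> v *m Y *m M' = 0.
  rewrite -mulmxA -MX mulmxA; split=> [->|vMX0]; first by rewrite mul0mx.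
  by rewrite -[v *m M]mulmx1 -XXi mulmxA vMX0 mul0mx.
split=> [/vM0/exM'N'[w vY]|[w vN]].
  exists (w *m Zi); rewrite -[v]mulmx1 -YYi mulmxA vY -[N]mulmx1 -YYi [N *m _]mulmxA NY.
  by rewrite !mulmxA -(mulmxA w Zi Z) ZiZ mulmx1.
by apply/vM0/exM'N'; exists (w *m Z); rewrite vN -!mulmxA NY.
Qed.

Lemma mx_exact_diag p (d d' : 'rV[A]_p) :
  (forall j x, x * d 0 j = 0 <-> exists y, x = y * d' 0 j) ->
  mx_exact (diag_mx d) (diag_mx d').
Proof.
move=> exd v; split=> [vd0|[w ->]].
  have : forall j, exists y, v 0 j = y * d' 0 j.
    by move=> j; apply/exd; have /rowP/(_ j) := vd0; rewrite mul_mx_diag !mxE.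
  case/fin_all_exists => y vy; exists (\row_j y j); apply/rowP => j.
  by rewrite mul_mx_diag !mxE vy.
apply/rowP => j; rewrite !mul_mx_diag !mxE; apply/exd; by exists (w 0 j).
Qed.

End MatrixExactness.

(** * The triangle group: orders, infinitude and exactness from degree 2 on *)

Section TriangleGroup.
Context (l m n : nat).
Hypotheses (l_gt1 : (1 < l)%N) (m_gt1 : (1 < m)%N) (n_gt1 : (1 < n)%N).
Local Notation rels := (triangle_relators l m n).
Local Notation T := (triangle l m n).
Local Notation ZT := (group_ring int T).
Local Notation gr := (@gr_of int T).
Local Notation cls := (@pclass bool rels).
Local Notation tA := (triangle_a l m n).
Local Notation tB := (triangle_b l m n).
Local Notation tC := (tA * tB)%g.
Local Notation wa := [:: (false, false)].
Local Notation wb := [:: (true, false)].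
Local Notation a := (gr tA).
Local Notation b := (gr tB).
Local Notation Na := (@norm_elt l m n tA l.-1).
Local Notation Nb := (@norm_elt l m n tB m.-1).
Local Notation Nab := (@norm_elt l m n tC n.-1).
Local Notation Nba := (@norm_elt l m n (tB * tA)%g n.-1).

Lemma triangle_c_word : tC = cls (wa ++ wb).
Proof. by rewrite pclass_cat. Qed.

Lemma triangle_relations : [/\ (tA ^+ l = 1)%g, (tB ^+ m = 1)%g & (tC ^+ n = 1)%g].
Proof.
rewrite triangle_c_word -!pclass_exp.
by split; apply: pclass_rel; rewrite !inE eqxx ?orbT.
Qed.

Section Representation.
Context (R : realType) (A A' B B' : 'M[R]_2).
Hypothesis rep : half_turn_pair l m n A A' B B'.

Let letter (c : bool * bool) :=
  match c with
  | (false, false) => A | (false, true) => A' | (true, false) => B | (true, true) => B'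
  end.

(** This is the homomorphism to PSL_2(R), in the form needed to detect nontrivial elements. *)
Lemma triangle_eval u : cls u = 1%g -> pm1 (\prod_(c <- u) letter c).
Proof.
case: rep => [[AA' A'A] [BB' B'B] [Al _] [Bm _] [Cn _]] /pclassP u1.
have [||s ->] := word_eq_eval_sign (f := letter) _ _ u1.
- by case=> [] [].
- move=> r; rewrite !inE => /or3P[] /eqP ->; rewrite prod_word_exp !big_cons !big_nil mulr1.
  + by exists true.
  + by exists true.
  by case: Cn => ->; [exists false | exists true].
by rewrite big_nil mulr1; case: s; [right | left].
Qed.

Lemma triangle_exp_neq1 u M i :
  \prod_(c <- u) letter c = M -> ~ pm1 (M ^+ i) -> (cls u ^+ i != 1)%g.
Proof.
move=> <- Mi; apply/eqP; rewrite -pclass_exp => /triangle_eval.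
by rewrite prod_word_exp.
Qed.

Lemma triangle_orders :
  [/\ forall i, (0 < i < l)%N -> (tA ^+ i != 1)%g,
      forall i, (0 < i < m)%N -> (tB ^+ i != 1)%g
    & forall i, (0 < i < n)%N -> (tC ^+ i != 1)%g].
Proof.
case: rep => [_ _ [_ Ai] [_ Bi] [_ Ci]]; rewrite triangle_c_word.
split=> i lti; [apply: triangle_exp_neq1 (Ai i lti) | apply: triangle_exp_neq1 (Bi i lti)
               | apply: triangle_exp_neq1 (Ci i lti)];
  by rewrite !big_cons !big_nil ?mulr1.
Qed.

Lemma triangle_infinite : (forall k, ~ pm1 ((A * B * A' * B') ^+ k.+1)) ->
  exists h : T, forall i, (h ^+ i.+1 != 1)%g.
Proof.
move=> H_inf; exists (cls [:: (false, false); (true, false); (false, true); (true, true)]).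
move=> i; apply: triangle_exp_neq1 (H_inf i).
by rewrite !big_cons big_nil mulr1 !mulrA.
Qed.

End Representation.

Lemma triangle_orders_infinite : l%:R^-1 + m%:R^-1 + n%:R^-1 < 1 :> rat ->
  [/\ forall i, (0 < i < l)%N -> (tA ^+ i != 1)%g,
      forall i, (0 < i < m)%N -> (tB ^+ i != 1)%g,
      forall i, (0 < i < n)%N -> (tC ^+ i != 1)%g
    & exists h : T, forall i, (h ^+ i.+1 != 1)%g].
Proof.
move=> hyp; pose R := Rdefinitions.RbaseSymbolsImpl.R : realType.
have : l%:R^-1 + m%:R^-1 + n%:R^-1 < 1 :> R.
  by move: hyp; rewrite -(ltr_rat R) !rmorphD /= !fmorphV !rmorph_nat rmorph1.
case/hyperbolic_half_turns=> // A [A' [B [B' [rep H_inf]]]].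
have [oA oB oC] := triangle_orders rep.
by split=> //; apply: triangle_infinite rep H_inf.
Qed.

Hypothesis hyperbolic : l%:R^-1 + m%:R^-1 + n%:R^-1 < 1 :> rat.

Let exact_cyclic g k : (0 < k)%N -> (g ^+ k = 1)%g ->
    (forall i, (0 < i < k)%N -> (g ^+ i != 1)%g) ->
  (forall x : ZT, x * norm_elt g k.-1 = 0 <-> exists y, x = y * (gr g - 1)) /\
  (forall x : ZT, x * (gr g - 1) = 0 <-> exists y, x = y * norm_elt g k.-1).
Proof.
case: k => // k _ gk go; have {}go i : (0 < i <= k)%N -> (g ^+ i != 1)%g by apply: go.
by split=> x; [apply: mul_norm_eq0 | apply: mul_sub1_eq0].
Qed.

Local Notation Vsub1 := (\row_(j < 3) [:: a - 1; b - 1; gr tC - 1]`_j).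
Local Notation Vnorm := (\row_(j < 3) [:: Na; Nb; Nab]`_j).

Lemma exact_sub1_norm : mx_exact (diag_mx Vsub1) (diag_mx Vnorm).
Proof.
have [oA oB oC _] := triangle_orders_infinite hyperbolic.
have [eA eB eC] := triangle_relations.
apply: mx_exact_diag => -[[|[|[|//]]] ltj] x; rewrite !mxE /=.
- by have [_] := exact_cyclic (ltnW l_gt1) eA oA; apply.
- by have [_] := exact_cyclic (ltnW m_gt1) eB oB; apply.
by have [_] := exact_cyclic (ltnW n_gt1) eC oC; apply.
Qed.

Lemma exact_norm_sub1 : mx_exact (diag_mx Vnorm) (diag_mx Vsub1).
Proof.
have [oA oB oC _] := triangle_orders_infinite hyperbolic.
have [eA eB eC] := triangle_relations.
apply: mx_exact_diag => -[[|[|[|//]]] ltj] x; rewrite !mxE /=.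
- by have [] := exact_cyclic (ltnW l_gt1) eA oA.
- by have [] := exact_cyclic (ltnW m_gt1) eB oB.
by have [] := exact_cyclic (ltnW n_gt1) eC oC.
Qed.

(** * Change of bases to Fox derivatives and diagonal matrices *)

Local Notation mx := (@mx_of_rows l m n).

(* The rows of [partial2] are the Fox derivatives of a^l, (ab)^n b^-m and (ba)^n a^-l;
   [cells_basis] writes them in those of a^l, b^m and (ab)^n.  Likewise [relations_basis]
   writes the rows of [partial3] in (a - 1) e_a, (b - 1) e_b and (ab - 1) e_c. *)
Definition cells_basis : 'M[ZT]_3 :=
  mx 3 3 [:: [:: 1; 0; 0]; [:: 0; -1; 1]; [:: -1; 0; b]].
Definition relations_basis : 'M[ZT]_3 :=
  mx 3 3 [:: [:: 1; 0; 0]; [:: - b; 0; b]; [:: 1; 1; -1]].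
Definition fox_matrix : 'M[ZT]_(3, 2) :=
  mx 3 2 [:: [:: Na; 0]; [:: 0; Nb]; [:: Nab; Nab * a]].

Local Notation bV := (gr tB^-1%g).

Let bbV : b * bV = 1. Proof. by rewrite -gr_ofM mulgV. Qed.
Let bVb : bV * b = 1. Proof. by rewrite -gr_ofM mulVg. Qed.

Lemma norm_eltX g k : (0 < k)%N -> (g ^+ k = 1)%g -> norm_elt g k.-1 * gr g = norm_elt g k.-1.
Proof. by case: k => // k _; apply: norm_mulr. Qed.

Let NaA : Na * a = Na.
Proof. by have [eA _ _] := triangle_relations; apply: norm_eltX eA; apply: ltnW. Qed.

Let NbB : Nb * b = Nb.
Proof. by have [_ eB _] := triangle_relations; apply: norm_eltX eB; apply: ltnW. Qed.

Let NabC : Nab * a * b = Nab.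
Proof.
have [_ _ eC] := triangle_relations.
by rewrite -mulrA -gr_ofM; apply: norm_eltX eC; apply: ltnW.
Qed.

(** [ba] is the conjugate of [ab] by [b], which lets [Nba] be traded for [Nab]. *)
Let expg_ba i : ((tB * tA) ^+ i * tB = tB * tC ^+ i)%g.
Proof.
elim: i => [|i IHi]; first by rewrite mul1g mulg1.
by rewrite expgS -mulgA IHi expgS !mulgA.
Qed.

Let NbaB : Nba * b = b * Nab.
Proof.
by rewrite mulr_suml mulr_sumr; apply: eq_bigr => i _; rewrite -!gr_ofM expg_ba.
Qed.

Let NbaBA : Nba * b * a = Nba.
Proof.
rewrite -mulrA -gr_ofM; apply: norm_eltX; first exact: ltnW.
have [_ _ eC] := triangle_relations.
by apply: (mulIg tB); rewrite expg_ba eC mulg1 mul1g.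
Qed.

Ltac mx_entries :=
  apply/matrixP => -[[|[|[|//]]] ?] [[|[|[|//]]] ?];
  rewrite !mxE ?big_ord_recl ?big_ord0 !mxE /= ?mulr1n
    ?(mul0r, mulr0, mul1r, mulr1, addr0, add0r, mulN1r, mulrN1, oppr0, mulNr, mulrN)
    ?opprK ?bbV ?bVb ?subrr ?addNr //.

Lemma cells_basis_unit : exists X, mx_inverse cells_basis X.
Proof.
exists (mx 3 3 [:: [:: 1; 0; 0]; [:: bV; -1; bV]; [:: bV; 0; bV]]).
by split; mx_entries.
Qed.

Lemma relations_basis_unit : exists X, mx_inverse relations_basis X.
Proof.
exists (mx 3 3 [:: [:: 1; 0; 0]; [:: 0; bV; 1]; [:: 1; bV; 0]]).
by split; mx_entries.
Qed.

Lemma partial2_basis : partial2 l m n = cells_basis *m fox_matrix.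
Proof.
mx_entries.
- by rewrite addrC.
- by rewrite addrC NbaB.
by rewrite mulrA -NbaB NbaBA.
Qed.

Lemma partial3_basis :
  partial3 l m n *m cells_basis = relations_basis *m diag_mx Vsub1.
Proof.
mx_entries.
- by rewrite mulrBr mulr1 !opprB addrA subrK.
- by rewrite mulrBl mulrBr mulr1 mul1r gr_ofM mulrA.
- by rewrite opprB.
- by rewrite opprB.
by rewrite mulrBl mul1r addrA subrK opprB gr_ofM.
Qed.

Lemma partial4_basis :
  partial4 l m n *m relations_basis = cells_basis *m diag_mx Vnorm.
Proof.
mx_entries.
- by rewrite mulrBl NabC NbB opprB addrAC subrr sub0r subrr.
- by rewrite mulrBl NabC NbB subrK.
by rewrite addrAC subrr sub0r.
Qed.

Lemma right_invariant_generators (x : ZT) :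
  x * a = x -> x * b = x -> forall g, x * gr g = x.
Proof.
move=> xa xb g; rewrite -[g]pclassK; elim: (repr g) => [|c w IHw]; first exact: mulr1.
rewrite pclass_cons gr_ofM mulrA.
suff -> : x * gr (cls [:: c]) = x by [].
have xgen i : x * gr (pgen rels i) = x by case: i.
case: c => i []; last exact: xgen.
have -> : cls [:: (i, true)] = (pgen rels i)^-1%g by apply: pclass_pgenV.
rewrite -{1}(xgen i).
by rewrite -mulrA -gr_ofM mulgV; apply: mulr1.
Qed.

Lemma exact_fox_sub1 : mx_exact fox_matrix (diag_mx Vsub1).
Proof.
(* Two equations have to force three: the common term [u] must vanish by itself. *)
have fox_norm0 (v : 'rV_3) : v *m fox_matrix = 0 <-> v *m diag_mx Vnorm = 0.
  pose i0 : 'I_3 := ord0; pose i1 : 'I_3 := lift ord0 ord0.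
  pose i2 : 'I_3 := lift ord0 (lift ord0 ord0).
  have foxE : v *m fox_matrix = 0 <->
      v 0 i0 * Na + v 0 i2 * Nab = 0 /\ v 0 i1 * Nb + v 0 i2 * Nab * a = 0.
    split=> [/rowP v0|[e0 e1]].
      move: (v0 0) (v0 1); rewrite !mxE !big_ord_recl !big_ord0 !mxE /=.
      by rewrite !(mulr0, addr0, add0r) mulrA => e0 e1; split.
    apply/rowP => -[[|[|//]] ltj]; rewrite !mxE !big_ord_recl !big_ord0 !mxE /=;
      by rewrite !(mulr0, addr0, add0r) // mulrA.
  have normE : v *m diag_mx Vnorm = 0 <->
      [/\ v 0 i0 * Na = 0, v 0 i1 * Nb = 0 & v 0 i2 * Nab = 0].
    rewrite mul_mx_diag; split=> [/rowP v0|[e0 e1 e2]].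
      by split; [have := v0 i0 | have := v0 i1 | have := v0 i2]; rewrite !mxE.
    apply/rowP => -[[|[|[|//]]] ltj]; rewrite !mxE /=;
      [rewrite -[RHS]e0 | rewrite -[RHS]e1 | rewrite -[RHS]e2];
      by congr (v 0 _ * _); apply: val_inj.
  rewrite foxE normE; split=> [[e0 e1]|[-> -> ->]]; last by rewrite mul0r !addr0.
  set u := v 0 i2 * Nab in e0 e1 *.
  have u_Na : u = - (v 0 i0 * Na) by apply/eqP; rewrite -addr_eq0 addrC e0.
  have ua_Nb : u * a = - (v 0 i1 * Nb) by apply/eqP; rewrite -addr_eq0 addrC e1.
  (* [u] is a left multiple of [Na], hence fixed by [a]; then [u = u * a] is also a left multiple of
     [Nb], hence fixed by [b]. *)
  have ua : u * a = u by rewrite u_Na mulNr -mulrA NaA.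
  have ub : u * b = u by rewrite -ua ua_Nb mulNr -mulrA NbB.
  have [_ _ _ [h h_inf]] := triangle_orders_infinite hyperbolic.
  have u0 : u = 0.
    by apply: right_invariant_eq0 h_inf (right_invariant_generators ua ub h).
  by move: e0 e1; rewrite u0 mul0r !addr0.
by move=> v; rewrite fox_norm0; apply: exact_norm_sub1.
Qed.

Let mx_inverse1 p : @mx_inverse ZT p 1%:M 1%:M.
Proof. by split; rewrite mulmx1. Qed.

Lemma exact_partial23 : mx_exact (partial2 l m n) (partial3 l m n).
Proof.
have [P PV] := cells_basis_unit; have [Q QV] := relations_basis_unit.
apply: mx_exact_base_change (mx_inverse1 _) PV QV _ partial3_basis exact_fox_sub1.
by rewrite mulmx1 partial2_basis.
Qed.

Lemma exact_partial34 : mx_exact (partial3 l m n) (partial4 l m n).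
Proof.
have [P PV] := cells_basis_unit; have [Q QV] := relations_basis_unit.
exact: (mx_exact_base_change PV QV PV partial3_basis partial4_basis exact_sub1_norm).
Qed.

Lemma exact_partial43 : mx_exact (partial4 l m n) (partial3 l m n).
Proof.
have [P PV] := cells_basis_unit; have [Q QV] := relations_basis_unit.
exact: (mx_exact_base_change QV PV QV partial4_basis partial3_basis exact_norm_sub1).
Qed.

End TriangleGroup.

(** * Exactness in degrees 0 and 1 by Fox calculus *)

Section LowDegrees.
Context (l m n : nat).
Hypotheses (l_gt1 : (1 < l)%N) (m_gt1 : (1 < m)%N) (n_gt1 : (1 < n)%N).
Local Notation rels := (triangle_relators l m n).
Local Notation T := (triangle l m n).
Local Notation ZT := (group_ring int T).
Local Notation gr := (@gr_of int T).
Local Notation cls := (@pclass bool rels).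
Local Notation partial1 := (partial1 l m n).
Local Notation partial2 := (partial2 l m n).

Definition gen_vector (i : bool) : 'rV[ZT]_2 := delta_mx 0 (if i then 1 else 0).
Local Notation fox := (@fox bool rels _ gen_vector).

Lemma fox_partial1 u : fox u *m partial1 = (gr (cls u) - 1) *: const_mx 1.
Proof.
pose f := mulmxr partial1 : {linear 'rV[ZT]_2 -> 'rV[ZT]_1}.
apply: (@fox_boundary _ rels _ _ gen_vector f) => i.
apply/rowP => j; rewrite ord1 /f /= /gen_vector -rowE !mxE mulr1.
by case: i.
Qed.

(** On a group element, the Fox derivative of any word representing it is a preimage of [g - 1]. *)
Lemma aug_partial1 (x : ZT) :
  exists w : 'rV_2, w *m partial1 = (x - (gr_aug x)%:~R) *: const_mx 1.
Proof.
elim/gr_span: x => [x y [u ux] [v vy]|g].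
  exists (u - v); rewrite mulmxBl ux vy -scalerBl; congr (_ *: _).
  by rewrite [gr_aug (x - y)]raddfB /= mulrzBr opprD addrACA -opprD.
by exists (fox (repr g)); rewrite fox_partial1 pclassK gr_aug_of.
Qed.

Lemma exact_aug_partial1 (v : 'rV[ZT]_1) :
  augmentation v = 0 <-> exists w, v = w *m partial1.
Proof.
split=> [v0|[w ->]].
  have [w wv] := aug_partial1 (v 0 0); exists w.
  have -> : v = v 0 0 *: const_mx 1 by apply/rowP => j; rewrite ord1 !mxE mulr1.
  by rewrite wv (v0 : gr_aug (v 0 0) = 0) subr0.
rewrite /augmentation mxE raddf_sum big1 // => i _ /=.
rewrite rmorphM mxE; case: i => [[|[|//]] lti];
  by rewrite /= [gr_aug (_ - _)]raddfB /= rmorph1 gr_aug_of subrr mulr0.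
Qed.

Lemma norm_eltE (g : T) k : (0 < k)%N -> norm_elt g k.-1 = \sum_(i < k) gr (g ^+ i)%g.
Proof. by case: k. Qed.

(** Each relator is a power, and [fox_exp] turns the exponent into a norm factor. *)
Lemma fox_relator (i : 'I_3) : row i (fox_matrix l m n) = fox (nth [::] rels i).
Proof.
apply/rowP => j; case: i => [[|[|[|//]]] lti]; rewrite fox_exp !mxE /=
    ?(norm_eltE _ (ltnW l_gt1)) ?(norm_eltE _ (ltnW m_gt1)) ?(norm_eltE _ (ltnW n_gt1));
  rewrite ?triangle_c_word mulr0 addr0; case: j => [[|[|//]] ltj] /=;
  by rewrite ?(mulr0, mulr1, addr0, add0r).
Qed.

Lemma exact_partial12 : mx_exact partial1 partial2.
Proof.
have [P [PPi PiP]] := cells_basis_unit l m n.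
move=> v; split=> [v0|[w ->]].
  suff [w vw] : exists w, v = w *m fox_matrix l m n.
    by exists (w *m P); rewrite vw partial2_basis // mulmxA -(mulmxA w) PiP mulmx1.
  (* The row space of [fox_matrix] serves as the submodule generated by the derivatives of the
     relators. *)
  pose S (u : 'rV[ZT]_2) := exists w, u = w *m fox_matrix l m n.
  have SD x y : S x -> S y -> S (x + y).
    by case=> [u ->] [w ->]; exists (u + w); rewrite mulmxDl.
  have SZ r x : S x -> S (r *: x) by case=> [u ->]; exists (r *: u); rewrite scalemxAl.
  have S0 : S 0 by exists 0; rewrite mul0mx.
  have Srel r : r \in rels -> S (fox r).
    case/(nthP [::]) => i lti <-; exists (delta_mx 0 (Ordinal lti)).
    by rewrite -rowE fox_relator.
  have key x i := fox_mul_sub1 S0 SD SZ Srel x i.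
  have := SD _ _ (key (v 0 0) false) (key (v 0 1) true).
  have vE : v = v 0 0 *: gen_vector false + v 0 1 *: gen_vector true.
    apply/rowP => -[[|[|//]] ltj]; rewrite !mxE /= ?(mulr0, mulr1, addr0, add0r);
      by congr (v 0 _); apply: val_inj.
  have xy0 : v 0 0 * (gr (pgen rels false) - 1) + v 0 1 * (gr (pgen rels true) - 1) = 0.
    have := congr1 (fun x : 'rV_1 => x 0 0) v0; rewrite !mxE !big_ord_recl.
    rewrite big_ord0 !mxE addr0 => <-.
    by congr (v 0 _ * _ + v 0 _ * _); apply: val_inj.
  (* The two instances of [key] add up to the derivation applied to [v *m partial1], which is 0,
     minus [v]; so [- v] lies in [S]. *)
  rewrite addrACA -raddfD xy0 raddf0 add0r -opprD -vE.
  by move/(SZ (-1)); rewrite scaleN1r opprK.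
suff fox0 : fox_matrix l m n *m partial1 = 0.
  by rewrite partial2_basis // -!mulmxA fox0 !mulmx0.
apply/row_matrixP => i; rewrite row_mul fox_relator fox_partial1 row0.
rewrite pclass_rel ?subrr ?scale0r //; apply: mem_nth; exact: ltn_ord.
Qed.

End LowDegrees.

Theorem theorem8p12 (l m n : nat)
    (hl : (2 <= l)%N) (hlm : (l <= m)%N) (hmn : (m <= n)%N)
    (hyperbolic : l%:R^-1 + m%:R^-1 + n%:R^-1 < 1 :> rat) :
  is_free_resolution (M := trivial_module int (triangle l m n))
    (@triangle_diff l m n) (@augmentation int (triangle l m n)).
Proof.
have hm := leq_trans hl hlm; have hn := leq_trans hm hmn.
split=> [y|v|[|[|k]] v].
- exists (\row_j (y : int)%:~R).
  by rewrite /= /augmentation mxE rmorph_int intz.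
- exact: exact_aug_partial1.
- exact: exact_partial12.
- exact: exact_partial23.
(* The differential [triangle_diff k.+2] leaves degree [k + 3], so for odd [k] it is [partial4]. *)
rewrite /triangle_diff /= !negbK; case: (odd k).
  exact: exact_partial43.
exact: exact_partial34.
Qed.
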